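(* Let $A$ be a $C^*$-algebra and let $L \subseteq A$ be a Lie ideal. Then the following are equivalent: (i) $[A,L]$ generates $A$ as a not necessarily closed ideal; (ii) $[L,L]$ generates $A$ as a not necessarily closed ideal; (iii) $[[L,L],[L,L]]$ generates $A$ as a not necessarily closed ideal. Moreover, if this is the case, then $[A,A] = [L,L] \subseteq L$.
   Context: $C^*$-algebras are not assumed to be unital. For subsets $X, Y$ of a $C^*$-algebra, $[X,Y]$ denotes the linear span (no closure) of the set of commutators $[x,y] := xy - yx$ with $x \in X$, $y \in Y$. A (not necessarily closed) linear subspace $L \subseteq A$ is a Lie ideal if $[A,L] \subseteq L$. Ideals are two-sided and not necessarily closed. A subspace $M \subseteq A$ generates $A$ as a not necessarily closed ideal if the (algebraic) ideal generated by $M$, namely $\widetilde{A}M\widetilde{A} = M + AM + MA + AMA$, equals $A$; here $\widetilde{A}$ is the minimal unitization of $A$ (with $\widetilde{A} = A$ if $A$ is unital), and products of subsets denote linear spans of the sets of products. *)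

(* Defs.v *)
From HB Require Import structures.
From mathcomp Require Import all_boot all_order all_algebra.
From mathcomp Require Import complex.
From mathcomp Require Import boolp classical_sets reals topology normedtype.

Set Implicit Arguments.
Unset Strict Implicit.
Unset Printing Implicit Defensive.

Import Order.TTheory GRing.Theory Num.Theory.
Import numFieldNormedType.Exports.

Local Open Scope classical_set_scope.
Local Open Scope ring_scope.
Local Open Scope complex_scope.

Declare Scope cstar_scope.
Delimit Scope cstar_scope with cstar.

(* The ring structures of the library are unital, so the multiplication of a
   possibly non-unital algebra is a field of the mixin.  The norm takes its
   values in the nonnegative elements of R[i], which are real. *)
HB.mixin Record isCStarAlgebra (R : realType) A
    & CompleteNormedModule R[i] A := {
  cmul : A -> A -> A;
  cadj : A -> A;
  cmulA : associative cmul;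
  cmulDl : left_distributive cmul +%R;
  cmulDr : right_distributive cmul +%R;
  cscaleAl : forall (a : R[i]) (x y : A), a *: cmul x y = cmul (a *: x) y;
  cscaleAr : forall (a : R[i]) (x y : A), a *: cmul x y = cmul x (a *: y);
  cadjK : involutive cadj;
  cadjD : {morph cadj : x y / x + y};
  cadjZ : forall (a : R[i]) (x : A), cadj (a *: x) = Num.conj a *: cadj x;
  cadjM : forall x y : A, cadj (cmul x y) = cmul (cadj y) (cadj x);
  cnormM_le : forall x y : A, `|cmul x y| <= `|x| * `|y|;
  cnorm_adjM : forall x : A, `|cmul (cadj x) x| = `|x| ^+ 2
}.

#[short(type="cstarAlgType")]
HB.structure Definition CStarAlgebra (R : realType) :=
  { A of isCStarAlgebra R A & CompleteNormedModule R[i] A }.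

Notation "x ** y" := (cmul x y) (at level 40, left associativity) : cstar_scope.
Local Open Scope cstar_scope.

Section Subspaces.
Variables (R : realType) (A : cstarAlgType R).
Implicit Types (a : R[i]) (x y : A) (X Y L M J : set A).

Definition linear_subspace X : Prop := submod_closed (mem X).

Definition lspan X : set A := smallest linear_subspace X.

Definition commutator x y : A := x ** y - y ** x.

Definition comm_span X Y : set A :=
  lspan [set commutator x y | x in X & y in Y].

Definition mul_span X Y : set A := lspan [set x ** y | x in X & y in Y].

Definition set_add X Y : set A := [set x + y | x in X & y in Y].

Definition lie_ideal L : Prop := linear_subspace L /\ comm_span setT L `<=` L.

Definition ideal J : Prop :=
  [/\ linear_subspace J, mul_span setT J `<=` J & mul_span J setT `<=` J].

(* M + AM + MA + AMA, that is, the product of M on both sides with the minimal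
   unitization of A (see ideal_spanE). *)
Definition ideal_span M : set A :=
  set_add (set_add (set_add M (mul_span setT M)) (mul_span M setT))
          (mul_span (mul_span setT M) setT).

Definition generates_as_ideal M : Prop := ideal_span M = setT.

Lemma linear_subspaceP X : linear_subspace X <->
  X 0 /\ forall a x y, X x -> X y -> X (a *: x + y).
Proof.
split=> -[X0 XD]; split.
- exact: set_mem X0.
- by move=> a x y Xx Xy; apply/set_mem/XD; apply/mem_set.
- exact: mem_set X0.
- by move=> a x y /set_mem Xx /set_mem Xy; apply/mem_set/XD.
Qed.

Lemma lspan_subspace X : linear_subspace (lspan X).
Proof.
apply/linear_subspaceP; split=> [L [/linear_subspaceP[]//]|a x y Xx Xy L [sL XL]].
case/linear_subspaceP: (sL) => _; apply; first exact: Xx.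
exact: Xy.
Qed.

Lemma sub_lspan X : X `<=` lspan X.
Proof. exact: sub_gen_smallest. Qed.

Lemma lspan_min X L : linear_subspace L -> X `<=` L -> lspan X `<=` L.
Proof. exact: smallest_sub. Qed.

Lemma set_add_subspace X Y :
  linear_subspace X -> linear_subspace Y -> linear_subspace (set_add X Y).
Proof.
move=> /linear_subspaceP[X0 XD] /linear_subspaceP[Y0 YD].
apply/linear_subspaceP; split.
  by exists 0 => //; exists 0 => //; rewrite addr0.
move=> a _ _ [x Xx [y Yy <-]] [x' Xx' [y' Yy' <-]].
exists (a *: x + x'); first exact: XD.
exists (a *: y + y'); first exact: YD.
by rewrite scalerDr addrACA.
Qed.

Lemma mul_span_l x X L : linear_subspace L ->
  (forall y, X y -> L (x ** y)) -> forall y, lspan X y -> L (x ** y).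
Proof.
move=> /linear_subspaceP[L0 LD] XL.
apply: (@lspan_min X (fun y => L (x ** y))) => //.
apply/linear_subspaceP; split=> [|a y y' Ly Ly'].
  by rewrite -(scale0r 0) -cscaleAr scale0r.
by rewrite cmulDr -cscaleAr; apply: LD.
Qed.

Lemma mul_span_r x X L : linear_subspace L ->
  (forall y, X y -> L (y ** x)) -> forall y, lspan X y -> L (y ** x).
Proof.
move=> /linear_subspaceP[L0 LD] XL.
apply: (@lspan_min X (fun y => L (y ** x))) => //.
apply/linear_subspaceP; split=> [|a y y' Ly Ly'].
  by rewrite -(scale0r 0) -cscaleAl scale0r.
by rewrite cmulDl -cscaleAl; apply: LD.
Qed.

Lemma mul_spanM X Y x y : X x -> Y y -> mul_span X Y (x ** y).
Proof. by move=> Xx Yy; apply: sub_lspan; exists x => //; exists y. Qed.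

Lemma ideal_spanE M : linear_subspace M -> ideal_span M = smallest ideal M.
Proof.
move=> sM; have sS X Y : linear_subspace (mul_span X Y) by exact: lspan_subspace.
have s2 : linear_subspace (set_add M (mul_span setT M)) by exact: set_add_subspace.
have s3 : linear_subspace
    (set_add (set_add M (mul_span setT M)) (mul_span M setT)).
  exact: set_add_subspace.
have s4 : linear_subspace (ideal_span M) by exact: set_add_subspace.
have h0 X : linear_subspace X -> X 0 by case/linear_subspaceP.
have addl X Y : linear_subspace Y -> X `<=` set_add X Y.
  by move=> sY x Xx; exists x => //; exists 0; [exact: h0|rewrite addr0].
have addrr X Y : linear_subspace X -> Y `<=` set_add X Y.
  by move=> sX y Yy; exists 0; [exact: h0|exists y => //; rewrite add0r].
have iM : M `<=` ideal_span M.
  by move=> x Mx; apply/addl/addl/addl.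
have iAM : mul_span setT M `<=` ideal_span M.
  by move=> x Mx; apply/addl/addl => //; apply: addrr.
have iMA : mul_span M setT `<=` ideal_span M.
  by move=> x Mx; apply: addl => //; apply: addrr.
have iAMA : mul_span (mul_span setT M) setT `<=` ideal_span M.
  by move=> x Mx; apply: addrr.
have addT x y : ideal_span M x -> ideal_span M y -> ideal_span M (x + y).
  case/linear_subspaceP: (s4) => _ D Ix Iy.
  by have := D 1 x y Ix Iy; rewrite scale1r.
have AAM x : forall y, mul_span setT M y -> mul_span setT M (x ** y).
  apply: mul_span_l => // _ [y _ [m Mm <-]].
  by rewrite cmulA; apply: mul_spanM.
apply/seteqP; split; last first.
  apply: smallest_sub => //; split=> //; apply: lspan_min => //.
    move=> _ [x _ [_ [_ [_ [m Mm [p Ip <-]] [q Iq <-]] [r Ir <-]] <-]].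
    rewrite !cmulDr; apply: (addT); first apply: (addT); first apply: (addT).
    - by apply: iAM; apply: mul_spanM.
    - by apply: iAM; apply: AAM.
    - apply: mul_span_l q Iq => // _ [m' Mm' [y _ <-]].
      by rewrite cmulA; apply: iAMA; apply: mul_spanM => //; apply: mul_spanM.
    - apply: mul_span_l r Ir => // _ [m' Mm' [y _ <-]].
      by rewrite cmulA; apply: iAMA; apply: mul_spanM => //; apply: AAM.
  move=> _ [_ [_ [_ [m Mm [p Ip <-]] [q Iq <-]] [r Ir <-]] [x _ <-]].
  rewrite !cmulDl; apply: (addT); first apply: (addT); first apply: (addT).
  - by apply: iMA; apply: mul_spanM.
  - by apply: iAMA; apply: mul_spanM.
  - apply: mul_span_r q Iq => // _ [m' Mm' [y _ <-]].
    by rewrite -cmulA; apply: iMA; apply: mul_spanM.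
  - apply: mul_span_r r Ir => // _ [m' Mm' [y _ <-]].
    by rewrite -cmulA; apply: iAMA; apply: mul_spanM.
move=> _ [_ [_ [m Mm [p Ip <-]] [q Iq <-]] [r Ir <-]] J [[sJ AJ JA] MJ].
have addJ x y : J x -> J y -> J (x + y).
  case/linear_subspaceP: (sJ) => _ D Jx Jy.
  by have := D 1 x y Jx Jy; rewrite scale1r.
have AMJ : mul_span setT M `<=` J.
  by apply: lspan_min => // _ [x _ [y /MJ Jy <-]]; apply: AJ; apply: mul_spanM.
apply: (addJ); first apply: (addJ); first apply: (addJ).
- exact: MJ.
- exact: AMJ.
- apply: lspan_min q Iq => // _ [x /MJ Jx [y _ <-]]; by apply: JA; apply: mul_spanM.
- apply: lspan_min r Ir => // _ [x /AMJ Jx [y _ <-]]; by apply: JA; apply: mul_spanM.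
Qed.

End Subspaces.

(* Main.v *)
(* Modulo an ideal I containing [L, L], every s = [x, a] with x in L satisfies
   s s = s A s = 0.  Modulo an ideal I containing [A, [L, L]], every c = [x, y]
   with x, y in L is central and c^3 = 0.  In both cases a set generating A
   consists of elements generating nilpotent ideals modulo I, so every element
   of A has a power in I.  This forces I = A although I is not closed: for h
   self-adjoint, w = ih has the bounded resolvents (e + w)^-1, and an infinite
   product of them gives, as in Cohen's factorization theorem, a single b in A
   with w in b^n A for all n; taking b^n in I gives h in I.  Hence
   (i) => (ii) => [A, [L, L]] generates A => (iii), the last step being
   (i) => (ii) for the Lie ideal [L, L].  Finally, when [L, L] generates A, the
   subring {t | [t, A] <= L} contains the ideal generated by [L, L], so
   [A, A] <= L; for the Lie ideal [L, L] and (iii) this is the last claim. *)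

Require Import Defs.
From mathcomp Require Import all_boot all_order all_algebra.
From mathcomp Require Import zify ring lra complex.
From mathcomp Require Import boolp classical_sets reals topology normedtype.

Set Implicit Arguments.
Unset Strict Implicit.
Unset Printing Implicit Defensive.

Import Order.TTheory GRing.Theory Num.Theory.
Import numFieldNormedType.Exports.

Local Open Scope classical_set_scope.
Local Open Scope ring_scope.
Local Open Scope complex_scope.
Local Open Scope cstar_scope.

(** * Linear identities by reflection *)

Inductive lincomb (K : Type) :=
  | LVar of nat | LZero | LOpp of lincomb K
  | LAdd of lincomb K & lincomb K | LScale of K & lincomb K.

Fixpoint lc_eval (K : comPzRingType) (V : lmodType K) (env : seq V)
    (e : lincomb K) : V :=
  match e with
  | LVar i => nth 0 env i | LZero => 0 | LOpp e => - lc_eval env e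
  | LAdd e f => lc_eval env e + lc_eval env f
  | LScale a e => a *: lc_eval env e
  end.

Fixpoint lc_coef (K : comPzRingType) (e : lincomb K) (j : nat) : K :=
  match e with
  | LVar i => if i == j then 1 else 0 | LZero => 0 | LOpp e => - lc_coef e j
  | LAdd e f => lc_coef e j + lc_coef f j
  | LScale a e => a * lc_coef e j
  end.

Lemma lc_evalE (K : comPzRingType) (V : lmodType K) (env : seq V)
    (e : lincomb K) :
  lc_eval env e = \sum_(j < size env) lc_coef e j *: nth 0 env j.
Proof.
elim: e => [i||e IH|e IHe f IHf|a e IH] /=.
- have [i_lt|i_ge] := ltnP i (size env).
    rewrite (bigD1 (Ordinal i_lt)) //= eqxx scale1r big1 ?addr0 // => j.
    by rewrite -val_eqE eq_sym => /negbTE /= ->; rewrite scale0r.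
  rewrite nth_default // big1 // => j _.
  by rewrite gtn_eqF ?scale0r // (leq_trans (ltn_ord j)).
- by rewrite big1 // => j _; rewrite scale0r.
- by rewrite IH -sumrN; apply: eq_bigr => j _; rewrite scaleNr.
- by rewrite IHe IHf -big_split; apply: eq_bigr => j _; rewrite scalerDl.
- by rewrite IH scaler_sumr; apply: eq_bigr => j _; rewrite scalerA.
Qed.

(** A recursive conjunction, so that [cbn] turns it into one scalar goal per atom. *)
Fixpoint forall_lt (n : nat) (P : nat -> Prop) : Prop :=
  if n is m.+1 then P m /\ forall_lt m P else True.

Lemma lc_eq (K : comPzRingType) (V : lmodType K) (env : seq V)
    (e f : lincomb K) :
  forall_lt (size env) (fun j => lc_coef e j = lc_coef f j) ->
  lc_eval env e = lc_eval env f.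
Proof.
move=> ef; rewrite !lc_evalE; apply: eq_bigr => -[j j_lt] _ /=; congr (_ *: _).
elim: (size env) ef j_lt => //= n IH [efn /IH {}IH].
by rewrite ltnS leq_eqVlt => /predU1P[->|].
Qed.

Ltac lc_mem x env :=
  lazymatch env with
  | nil => constr:(false)
  | x :: _ => constr:(true)
  | _ :: ?env => lc_mem x env
  end.
Ltac lc_index x env :=
  lazymatch env with
  | x :: _ => constr:(0%N)
  | _ :: ?env => let i := lc_index x env in constr:(i.+1)
  end.
Ltac lc_atoms t env :=
  lazymatch t with
  | ?x + ?y => let env := lc_atoms x env in lc_atoms y env
  | - ?x => lc_atoms x env
  | ?a *: ?x => lc_atoms x env
  | 0 => env
  | _ => lazymatch lc_mem t env with
         | true => env
         | false => constr:(t :: env)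
         end
  end.
Ltac lc_reify K t env :=
  lazymatch t with
  | ?x + ?y => let e := lc_reify K x env in let f := lc_reify K y env in
      constr:(LAdd e f)
  | - ?x => let e := lc_reify K x env in constr:(LOpp e)
  | ?a *: ?x => let e := lc_reify K x env in constr:(LScale (a : K) e)
  | 0 => constr:(LZero K)
  | _ => let i := lc_index t env in constr:(LVar K i)
  end.
(* Leaves the equality of the coefficients of each atom. *)
Ltac module_over K :=
  lazymatch goal with
  | |- @eq ?V ?x ?y =>
    let env := lc_atoms x (@nil V) in
    let env := lc_atoms y env in
    let e := lc_reify K x env in
    let f := lc_reify K y env in
    change (lc_eval env e = lc_eval env f); apply: lc_eq;
    cbn [forall_lt size lc_coef eqn eq_op]; repeat split; rewrite /=
  end.
Section Multiplication.
Variables (R : realType) (A : cstarAlgType R).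
Implicit Types (x y z a b h : A) (k : R[i]).

Lemma cmulZl k x y : (k *: x) ** y = k *: (x ** y).
Proof. by rewrite cscaleAl. Qed.

Lemma cmulZr k x y : x ** (k *: y) = k *: (x ** y).
Proof. by rewrite cscaleAr. Qed.

Lemma cmulNl x y : (- x) ** y = - (x ** y).
Proof. by rewrite -scaleN1r cmulZl scaleN1r. Qed.

Lemma cmulNr x y : x ** (- y) = - (x ** y).
Proof. by rewrite -scaleN1r cmulZr scaleN1r. Qed.

Lemma cmul0x x : 0 ** x = 0.
Proof. by rewrite -{1}(scale0r x) cmulZl scale0r. Qed.

Lemma cmulx0 x : x ** 0 = 0.
Proof. by rewrite -{1}(scale0r x) cmulZr scale0r. Qed.

End Multiplication.

(** Products are expanded into left-associated monomials, and these noncommutative words become the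
    atoms of a linear identity. *)
Ltac algebra_over K :=
  rewrite /commutator ?(cmulDl, cmulDr, cmulNl, cmulNr, cmulA,
    cmulZl, cmulZr, cmul0x, cmulx0);
  module_over K.

(** * Real-valued norm and geometric convergence *)

Section RealNorm.
Variables (R : realType) (A : cstarAlgType R).
Implicit Types (x y z a b h : A) (k : R[i]).

Definition rnorm (x : A) : R := complex.Re `|x|.
Local Notation "'N x" := (rnorm x) (at level 10, x at level 8).

Lemma rnormE x : `|x| = ('N x)%:C.
Proof. by rewrite RRe_real ?normr_real. Qed.

Lemma rnorm_ge0 x : 0 <= 'N x.
Proof. by rewrite -ler0c -rnormE normr_ge0. Qed.

Lemma rnormD x y : 'N (x + y) <= 'N x + 'N y.
Proof. by rewrite -lecR rmorphD /= -!rnormE ler_normD. Qed.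

Lemma rnormN x : 'N (- x) = 'N x.
Proof. by rewrite /rnorm normrN. Qed.

Lemma rnormB x y : 'N (x - y) <= 'N x + 'N y.
Proof. by rewrite -(rnormN y) rnormD. Qed.

Lemma rnorm_distC x y : 'N (x - y) = 'N (y - x).
Proof. by rewrite -rnormN opprB. Qed.

Lemma rnorm0 : 'N (0 : A) = 0.
Proof. by rewrite /rnorm normr0. Qed.

Lemma rnorm_eq0 x : 'N x = 0 -> x = 0.
Proof. by move=> x0; apply: normr0_eq0; rewrite rnormE x0. Qed.

Lemma rnormZ (c : R) x : 'N (c%:C *: x) = `|c| * 'N x.
Proof.
apply: complexI; rewrite rmorphM /= -!rnormE normrZ; congr (_ * _).
by rewrite normc_def /= expr0n addr0 sqrtr_sqr.
Qed.

Lemma rnormZi x : 'N ('i *: x) = 'N x.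
Proof.
apply: complexI; rewrite -!rnormE normrZ normc_def /= expr0n add0r expr1n.
by rewrite sqrtr1 mul1r.
Qed.

Lemma rnormM x y : 'N (x ** y) <= 'N x * 'N y.
Proof. by rewrite -lecR rmorphM /= -!rnormE cnormM_le. Qed.

Lemma rnorm_adjM x : 'N (cadj x ** x) = 'N x ^+ 2.
Proof. by apply: complexI; rewrite rmorphXn /= -!rnormE cnorm_adjM. Qed.

Lemma rnorm_adj x : 'N (cadj x) = 'N x.
Proof.
(* The C*-identity gives [|y|^2 <= |y*| |y|]. *)
have le y : 'N y <= 'N (cadj y).
  have := rnorm_adjM y; have := rnormM (cadj y) y.
  have := rnorm_ge0 y; have := rnorm_ge0 (cadj y); nra.
by apply/eqP; rewrite eq_le le -{2}(cadjK x) le.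
Qed.

Lemma half_expn_small (K e : R) : 0 <= K -> 0 < e ->
  exists n, K * 2^-1 ^+ n < e.
Proof.
move=> K0 e0; have Ke0 : 0 <= K / e by rewrite divr_ge0 // ltW.
exists (Num.bound (K / e)); set n := Num.bound _.
have n_lt : K / e < 2 ^+ n.
  apply: lt_trans (archi_boundP Ke0) _.
  by rewrite -natrX ltr_nat ltn_expl.
rewrite exprVn -/n ltr_pdivrMr ?exprn_gt0 //.
by move: n_lt; rewrite ltr_pdivrMr // mulrC.
Qed.

Lemma rnorm_small x (K : R) : (forall n, 'N x <= K * 2^-1 ^+ n) -> x = 0.
Proof.
move=> xK; apply/rnorm_eq0/eqP; rewrite eq_le rnorm_ge0 andbT leNgt.
apply/negP => x0; have K0 : 0 <= K.
  by have := xK 0%N; rewrite expr0 mulr1; apply: le_trans (rnorm_ge0 _).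
by have [n] := half_expn_small K0 x0; rewrite ltNge xK.
Qed.

(** The constant [K'] may depend on [m], so one limit comes with an error estimate at every
    stage. *)
Lemma geometric_limit (u : nat -> A) (K : R) :
  (forall j, 'N (u j.+1 - u j) <= K * 2^-1 ^+ j) ->
  exists l, forall m (K' : R),
    (forall j, 'N (u (m + j).+1 - u (m + j)%N) <= K' * 2^-1 ^+ j) ->
    'N (l - u m) <= 2 * K'.
Proof.
move=> uK.
have dist m (K' : R) n :
    (forall j, 'N (u (m + j).+1 - u (m + j)%N) <= K' * 2^-1 ^+ j) ->
    'N (u (m + n)%N - u m) <= 2 * K' * (1 - 2^-1 ^+ n).
  move=> uK'; elim: n => [|n IH].
    by rewrite addn0 subrr rnorm0 expr0; lra.
  have -> : u (m + n.+1)%N - u m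
      = (u (m + n).+1 - u (m + n)%N) + (u (m + n)%N - u m).
    by rewrite addnS addrA subrK.
  apply: le_trans (rnormD _ _) _; have := uK' n; rewrite exprS; lra.
have p0 n : 0 < 2^-1 ^+ n :> R by rewrite exprn_gt0 ?invr_gt0.
have dist' m (K' : R) n :
    (forall j, 'N (u (m + j).+1 - u (m + j)%N) <= K' * 2^-1 ^+ j) ->
    'N (u (m + n)%N - u m) <= 2 * K'.
  move=> uK'; apply: le_trans (dist _ _ _ uK') _.
  have K'0 : 0 <= K'.
    by have := uK' 0%N; rewrite expr0 mulr1; apply: le_trans (rnorm_ge0 _).
  have := p0 n; nra.
have K0 : 0 <= K.
  by have := uK 0%N; rewrite expr0 mulr1; apply: le_trans (rnorm_ge0 _).
have tail m j : 'N (u (m + j).+1 - u (m + j)%N) <= (K * 2^-1 ^+ m) * 2^-1 ^+ j.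
  by rewrite -mulrA -exprD.
have u_cauchy : cauchy (u @ \oo).
  apply: cauchy_exP => e e0; have [er e0r] : exists er : R, e = er%:C.
    by exists (complex.Re e); rewrite RRe_real // ger0_real // ltW.
  rewrite {}e0r ltcR in e0 *.
  have [m Km] := half_expn_small (mulr_ge0 (ler0n R 2) K0) e0.
  exists (u m); exists m => // n /= mn; rewrite -ball_normE /= -opprB normrN.
  rewrite rnormE ltcR; apply: le_lt_trans Km.
  by rewrite -(subnKC mn) -mulrA; apply: dist'.
have ul : u @ \oo --> lim (u @ \oo) by apply: cauchy_cvg.
pose l : A := lim (u @ \oo).
exists l => m K' uK'; rewrite leNgt; apply/negP => lt.
have e0 : 0 < ('N (l - u m) - 2 * K')%:C by rewrite ltcR subr_gt0.
have /= [N _ Nlt] := cvgr_dist_lt _ _ ul _ e0.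
have := Nlt (m + N)%N; rewrite /= leq_addl rnormE ltcR => /(_ isT).
rewrite ltNge lerBlDr => /negP; apply.
have -> : l - u m = (l - u (m + N)%N) + (u (m + N)%N - u m).
  by rewrite addrA subrK.
by apply: le_trans (rnormD _ _) _; rewrite lerD2l dist'.
Qed.
End RealNorm.

(** * Resolvents of skew-adjoint elements *)

Section Resolvent.
Variables (R : realType) (A : cstarAlgType R).
Implicit Types (x y z a b h : A) (k : R[i]).
Local Notation "'N x" := (rnorm x) (at level 10, x at level 8).

Lemma fixed_point (f : A -> A) :
  (forall x y, 'N (f x - f y) <= 2^-1 * 'N (x - y)) -> exists x, f x = x.
Proof.
move=> fK; pose u n := iter n f 0.
have uK j : 'N (u j.+1 - u j) <= 'N (f 0) * 2^-1 ^+ j.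
  elim: j => [|j IH]; first by rewrite /u /= subr0 expr0 mulr1.
  by apply: le_trans (fK _ _) _; rewrite exprS; lra.
have [l ul] := geometric_limit uK; exists l.
apply/eqP; rewrite -subr_eq0; apply/eqP.
apply: (@rnorm_small _ _ _ (2 * 'N (f 0))) => n.
have ul' m : 'N (l - u m) <= 2 * ('N (f 0) * 2^-1 ^+ m).
  by apply: ul => j; rewrite -mulrA -exprD.
have -> : f l - l = (f l - f (u n)) - (l - u n.+1) by rewrite opprB addrA subrK.
apply: le_trans (rnormB _ _) _; have := fK l (u n); have := ul' n.
have := ul' n.+1; rewrite exprS; lra.
Qed.

(* [c y + i h y] and [c y - i h y] have the same norm, by the C*-identity. *)
Lemma skew_lower_bound h y (c : R) : cadj h = h -> 0 <= c ->
  c * 'N y <= 'N (c%:C *: y + ('i *: h) ** y).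
Proof.
move=> hh c0; pose z := 'i *: (h ** y).
have adjz : cadj z = - ('i *: (cadj y ** h)).
  rewrite /z cadjZ cadjM hh -scaleNr; congr (_ *: _).
  by apply/eqP; rewrite eq_complex /= oppr0 !eqxx.
have adjcy : cadj (c%:C *: y) = c%:C *: cadj y.
  by rewrite cadjZ; congr (_ *: _); apply: conjc_real.
have adjN x : cadj (- x) = - cadj x.
  have -> : - x = (-1) *: x by rewrite scaleN1r.
  by rewrite cadjZ rmorphN1 scaleN1r.
(* The cross terms [c y* z] and [c z* y] cancel because [h] is self-adjoint. *)
have sqE : 'N (c%:C *: y + z) ^+ 2 = 'N (c%:C *: y - z) ^+ 2.
  rewrite -!rnorm_adjM !cadjD !adjN adjcy adjz; congr rnorm.
  rewrite /z; algebra_over (R[i]); ring.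
have -> : ('i *: h) ** y = z by rewrite cmulZl.
have cyE : c%:C *: y + c%:C *: y = (c%:C *: y + z) + (c%:C *: y - z).
  by module_over (R[i]); ring.
have : 2 * (c * 'N y) <= 'N (c%:C *: y + z) + 'N (c%:C *: y - z).
  apply: le_trans (rnormD _ _); rewrite -cyE -scalerDl -rmorphD rnormZ.
  by rewrite ger0_norm ?addr_ge0 //; lra.
have -> : 'N (c%:C *: y - z) = 'N (c%:C *: y + z); last by lra.
by apply/eqP; rewrite -(@eqrXn2 _ 2) ?rnorm_ge0 // sqE.
Qed.

(* By the lower bound, halving the scalar is a perturbation of relative size
   1/2. *)
Lemma skew_resolvent h (j : nat) x : cadj h = h -> 'N h <= 2^-1 ->
  exists y, (2^-1 ^+ j)%:C *: y + ('i *: h) ** y = x.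
Proof.
move=> hh h_le; elim: j x => [|j IH] x.
  have [|y yE] := @fixed_point (fun y => x - ('i *: h) ** y).
    move=> y z /=; have -> : x - ('i *: h) ** y - (x - ('i *: h) ** z)
        = ('i *: h) ** (z - y) by algebra_over (R[i]); ring.
    apply: le_trans (rnormM _ _) _; rewrite rnormZi (rnorm_distC z).
    by rewrite ler_wpM2r ?rnorm_ge0.
  by exists y; rewrite expr0 scale1r -{1}yE subrK.
pose c : R := 2^-1 ^+ j.+1.
have c0 : 0 < c by rewrite exprn_gt0 ?invr_gt0.
have cE : 2^-1 ^+ j = 2 * c by rewrite /c exprS; lra.
(* A fixed point of [f] solves [2cy + ihy = x + cy], which is the equation at the scalar [c]. *)
have [f fE] := choice (fun y => IH (x + c%:C *: y)).
have [|y yE] := @fixed_point f.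
  move=> y z.
  have : 2 * c * 'N (f y - f z) <= 'N (c%:C *: (y - z)).
    have <- : (2 * c)%:C *: (f y - f z) + ('i *: h) ** (f y - f z)
        = c%:C *: (y - z).
      have := fE y; have := fE z; rewrite cE.
      move=> fzE fyE; transitivity ((x + c%:C *: y) - (x + c%:C *: z)).
        by rewrite -fyE -fzE; algebra_over (R[i]); ring.
      by algebra_over (R[i]); ring.
    by apply: skew_lower_bound => //; rewrite mulr_ge0 ?ltW.
  by rewrite rnormZ gtr0_norm //; have := rnorm_ge0 (y - z); nra.
exists y; have := fE y; rewrite yE cE => /(congr1 (fun z => z - c%:C *: y)).
rewrite addrK => <-; rewrite -/c.
rewrite rmorphM; algebra_over (R[i]); rewrite ?rmorphM; ring.
Qed.
End Resolvent.

(** * Cohen factorization *)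

Section Factorization.
Variables (R : realType) (A : cstarAlgType R) (w : A) (r : nat -> A).
Local Notation "'N x" := (rnorm x) (at level 10, x at level 8).
Local Notation e j := ((2^-1 : R) ^+ j).
Hypothesis w_bound : forall y (c : R),
  0 <= c -> c * 'N y <= 'N (c%:C *: y + w ** y).
(* With e_j = 2^-j, this says that r_j = w / (w + e_j). *)
Hypothesis rE : forall j, (e j)%:C *: r j + w ** r j = w.

Let e_gt0 j : 0 < e j.
Proof. by rewrite exprn_gt0 ?invr_gt0. Qed.
Let e_ge0 j : 0 <= e j.
Proof. exact: ltW. Qed.
#[local] Hint Resolve e_gt0 e_ge0 : core.

Let e_le1 j : e j <= 1.
Proof. by rewrite exprn_ile1 // ?invr_ge0 // invf_le1 // ler1n. Qed.

Let e_homo i j : (i <= j)%N -> e j <= e i.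
Proof. by move=> ij; rewrite ler_wiXn2l ?invr_ge0 // invf_le1 // ler1n. Qed.

Let e_expn j : 2 ^+ j * e j = 1.
Proof. by rewrite -exprMn mulfV ?expr1n // pnatr_eq0. Qed.

(** Cancellation of [e_j + w]; identities between the [r_j] are proved below by multiplying both
    sides by it. *)
Let inj j x y : (e j)%:C *: x + w ** x = (e j)%:C *: y + w ** y -> x = y.
Proof.
move=> xy; apply/eqP; rewrite -subr_eq0; apply/eqP/rnorm_eq0/eqP.
have := w_bound (x - y) (ltW (e_gt0 j)).
have -> : (e j)%:C *: (x - y) + w ** (x - y)
    = ((e j)%:C *: x + w ** x) - ((e j)%:C *: y + w ** y).
  by algebra_over (R[i]); ring.
rewrite xy subrr rnorm0 pmulr_rle0 // => le0.
by rewrite eq_le le0 rnorm_ge0.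
Qed.

Let commw j : r j ** w = w ** r j.
Proof.
apply: (@inj j); transitivity (w ** w).
  by rewrite -{4}(rE j); algebra_over (R[i]); ring.
by rewrite -{2}(rE j); algebra_over (R[i]); ring.
Qed.

Let comm j k : r j ** r k = r k ** r j.
Proof.
apply: (@inj j); transitivity (w ** r k).
  by rewrite -{2}(rE j); algebra_over (R[i]); ring.
rewrite -commw -{1}(rE j) !(cmulDr, cmulZr, cmulA) commw.
by module_over (R[i]); ring.
Qed.

(** Formally [1 - r_j = e_j / (w + e_j)], a contraction by [w_bound]. *)
Let r_sub_le j x : 'N (x - r j ** x) <= 'N x.
Proof.
rewrite -(ler_pM2l (e_gt0 j)); apply: le_trans (w_bound _ (ltW (e_gt0 j))) _.
have -> : (e j)%:C *: (x - r j ** x) + w ** (x - r j ** x) = (e j)%:C *: x.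
  transitivity ((e j)%:C *: x + w ** x - ((e j)%:C *: r j + w ** r j) ** x).
    by algebra_over (R[i]); ring.
  by rewrite rE addrK.
by rewrite rnormZ gtr0_norm.
Qed.

Let rM_le j x : 'N (r j ** x) <= 2 * 'N x.
Proof.
have -> : r j ** x = x - (x - r j ** x) by rewrite subKr.
by apply: le_trans (rnormB _ _) _; have := r_sub_le j x; lra.
Qed.

(** There may be no unit to which [rM_le] could be applied; applied to the adjoint of [r_j] it gives
    [|r_j|^2 <= 2 |r_j|]. *)
Let r_le j : 'N (r j) <= 2.
Proof.
have := rM_le j (cadj (r j)).
have := rnorm_adjM (cadj (r j)); rewrite cadjK rnorm_adj => ->.
by have := rnorm_ge0 (r j); nra.
Qed.

(* That is, [(1 + r_j) / 2] and [2 - r_(j+1)] are inverse to each other. *)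
Let r_double j : 2 *: r j = r j.+1 + r j ** r j.+1.
Proof.
apply: (@inj j); transitivity (2 *: w).
  by rewrite -{2}(rE j); algebra_over (R[i]); ring.
transitivity (((e j)%:C *: r j + w ** r j) ** r j.+1
              + ((e j)%:C *: r j.+1 + w ** r j.+1)).
  rewrite (rE j) -{1}(rE j.+1) exprS rmorphM /= fmorphV.
  by algebra_over (R[i]); field.
by algebra_over (R[i]); ring.
Qed.

(** Both [e_k (1 - r_j) r_k] and [e_j (1 - r_k) r_j] equal [w (1 - r_j) (1 - r_k)]. *)
Let r_cross j k : e k * 'N (r k - r j ** r k) <= 2 * e j.
Proof.
have E : (e k)%:C *: (r k - r j ** r k) = (e j)%:C *: (r j - r k ** r j).
  have ek : (e k)%:C *: r k = w - w ** r k by rewrite -{1}(rE k) addrK.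
  have ej : (e j)%:C *: r j = w - w ** r j by rewrite -{1}(rE j) addrK.
  transitivity (w - w ** r k - r j ** (w - w ** r k)).
    by rewrite -ek; algebra_over (R[i]); ring.
  transitivity (w - w ** r j - r k ** (w - w ** r j)); last first.
    by rewrite -ej; algebra_over (R[i]); ring.
  rewrite !cmulDr !cmulNr !cmulA !commw -!cmulA (comm k j).
  by module_over (R[i]); ring.
have := rnormZ (e k) (r k - r j ** r k); rewrite E rnormZ !gtr0_norm // => <-.
rewrite mulrC ler_wpM2r //.
exact: le_trans (r_sub_le _ _) (r_le _).
Qed.

Let w_sub_le j : 'N (w - r j ** w) <= 2 * e j.
Proof.
rewrite commw -{1}(rE j) addrK rnormZ gtr0_norm // mulrC.
by rewrite ler_wpM2r ?r_le.
Qed.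

(* The subsequence makes [e_(m^2+m)] decay faster than any [q^m]. *)
Let t m := r (m * m + m)%N.
Let s m := r (m * m + m).+1.

(* [qprod x m] is [x] times the product of the [2 - s_k] for [k < m]. *)
Fixpoint qprod (x : A) (m : nat) : A :=
  if m is m'.+1 then qprod x m' + (qprod x m' - s m' ** qprod x m') else x.

Let qprod_le x m : 'N (qprod x m) <= 2 ^+ m * 'N x.
Proof.
elim: m => [|m IH]; first by rewrite expr0 mul1r.
rewrite /= exprS; apply: le_trans (rnormD _ _) _.
by have := r_sub_le (m * m + m).+1 (qprod x m); rewrite -/(s m); lra.
Qed.

Let qprod_sub x j m : qprod (x - r j ** x) m = qprod x m - r j ** qprod x m.
Proof.
elim: m => //= m ->; set y := qprod x m.
rewrite !cmulDr !cmulNr !cmulA (comm _ j) -/(s m).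
by module_over (R[i]); ring.
Qed.

Let qprod_step x m :
  'N (qprod x m - s m ** qprod x m) <= 2 ^+ m * 'N (x - s m ** x).
Proof. by rewrite -qprod_sub qprod_le. Qed.

(** This decay absorbs the growth [2^m] of [qprod] and passes to the quotient of [x] by [b], so that
    [b] can be divided out repeatedly. *)
Definition rapid (x : A) : Prop :=
  forall p, exists K, forall m, 'N (x - s m ** x) <= K * e (p * m).

(* [2^-m + pprod m] is the product of the [(1 + t_k) / 2] for [k < m], computed
   in the unitization of [A]. *)
Fixpoint pprod (m : nat) : A :=
  if m is m'.+1
  then 2^-1 *: (pprod m' + t m' ** pprod m' + (e m')%:C *: t m')
  else 0.

Let pprod_comm j m : r j ** pprod m = pprod m ** r j.
Proof.
elim: m => [|m IH]; first by rewrite /= cmulx0 cmul0x.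
rewrite /= !(cmulZl, cmulZr, cmulDl, cmulDr) IH cmulA (comm j) -cmulA IH.
by rewrite cmulA.
Qed.

(** A factor [(1 + t_m) / 2] costs at most [3/2]. By [r_cross] the added term [e_m t_m / 2]
    contributes at most half of the previous bound, so the bound at most doubles, while [2^(m^2)]
    grows at least as fast. *)
Let pprod_sub_le m j :
  'N (pprod m - r j ** pprod m) <= 2 * 2 ^+ (m * m) * e j.
Proof.
elim: m => [|m IH].
  by rewrite /= cmulx0 subr0 rnorm0 !mulr_ge0 ?exprn_ge0 ?invr_ge0.
set z := pprod m - r j ** pprod m in IH.
have -> : pprod m.+1 - r j ** pprod m.+1
    = (2^-1)%:C *: ((z + t m ** z) + (e m)%:C *: (t m - r j ** t m)).
  rewrite /= /z !(cmulZl, cmulZr, cmulDl, cmulDr, cmulNr) !cmulA.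
  rewrite (comm j) -/(t m).
  by rewrite fmorphV /= rmorph_nat; module_over (R[i]); ring.
rewrite rnormZ ger0_norm ?invr_ge0 //.
have z_le : 'N (z + t m ** z) <= 3 * 'N z.
  apply: le_trans (rnormD _ _) _.
  by have := rM_le (m * m + m) z; rewrite -/(t m); lra.
have t_le : e m * 'N (t m - r j ** t m) <= 2 * 2 ^+ (m * m) * e j.
  have := r_cross j (m * m + m); rewrite -/(t m).
  rewrite -(ler_pM2l (exprn_gt0 (m * m) (ltr0n R 2))).
  rewrite exprD !mulrA e_expn mul1r; lra.
have pow_le : 2 * 2 ^+ (m * m) <= 2 ^+ (m.+1 * m.+1) :> R.
  by rewrite -exprS ler_weXn2l ?ler1n //; nia.
apply: le_trans (_ : 2^-1 * (3 * 'N z + e m * 'N (t m - r j ** t m)) <= _).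
  rewrite ler_wpM2l ?invr_ge0 //; apply: le_trans (rnormD _ _) _.
  by rewrite rnormZ gtr0_norm // lerD2r.
have := ler_wpM2r (ltW (e_gt0 j)) pow_le; lra.
Qed.

(** The index [m^2 + m] of [t_m] is calibrated here: at [j = m^2 + m] the previous bound is exactly
    [2 e_m]. *)
Let pprod_step m : 'N (pprod m.+1 - pprod m) <= 2 * e m.
Proof.
have -> : pprod m.+1 - pprod m
    = (2^-1)%:C *: ((e m)%:C *: t m - (pprod m - t m ** pprod m)).
  by rewrite /= fmorphV /= rmorph_nat; module_over (R[i]); field.
rewrite rnormZ ger0_norm ?invr_ge0 //.
have t_le : 'N ((e m)%:C *: t m) <= 2 * e m.
  by rewrite rnormZ gtr0_norm // mulrC ler_wpM2r ?r_le.
have : 'N (pprod m - t m ** pprod m) <= 2 * e m.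
  apply: le_trans (pprod_sub_le _ _) _.
  by rewrite exprD mulrA -(mulrA 2) e_expn mulr1.
by have := rnormB ((e m)%:C *: t m) (pprod m - t m ** pprod m); lra.
Qed.

Let pprod_qprod x m : (e m)%:C *: qprod x m + pprod m ** qprod x m = x.
Proof.
elim: m => [|m IH]; first by rewrite /= expr0 scale1r cmul0x addr0.
rewrite -[RHS]IH; set y := qprod x m; set a := pprod m.
(* [d = 0] is [r_double] at [m^2 + m], that is, [(1 + t_m) / 2] and [2 - s_m] are inverse; the two
   sides differ by multiples of [d]. *)
pose d := 2 *: t m - s m - t m ** s m.
have d0 : d = 0 by rewrite /d /t /s r_double; module_over (R[i]); ring.
transitivity ((e m)%:C *: y + a ** y
    + 2^-1 *: (a ** (d ** y) + (e m)%:C *: (d ** y))); last first.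
  by rewrite d0 cmul0x cmulx0 scaler0 addr0 scaler0 addr0.
rewrite /= -/y -/a /d exprS rmorphM /= fmorphV /= rmorph_nat.
have -> : t m ** a = a ** t m by rewrite pprod_comm.
by algebra_over (R[i]); field.
Qed.

(** Here [b] is the limit of [pprod m], [y] that of [qprod x m], and [x = by] is the limit of
    [pprod_qprod]. The same [b] serves every rapid [x], and [y] is rapid again, so [w] lies in
    [b^n A] for all [n]. *)
Lemma factorization :
  exists b, rapid w /\ forall x, rapid x -> exists2 y, rapid y & x = b ** y.
Proof.
have [b b_lim] := geometric_limit pprod_step.
have b_le m : 'N (b - pprod m) <= 4 * e m.
  have -> : 4 * e m = 2 * (2 * e m) :> R by ring.
  by apply: b_lim => j; rewrite -mulrA -exprD.
exists b; split=> [p|x x_rapid].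
  (* This constant suffices because [pm <= p^2 + m^2 + m]. *)
  exists (2 ^+ (p * p)) => m; apply: le_trans (w_sub_le _) _.
  rewrite exprS mulrA mulfV ?pnatr_eq0 // mul1r.
  rewrite -(ler_pM2l (exprn_gt0 (m * m + m + p * m) (ltr0n R 2))).
  rewrite {1}addnC exprD -mulrA e_expn mulr1 mulrCA exprD -(mulrA _ _ (e _)).
  by rewrite e_expn mulr1 -exprD ler_weXn2l ?ler1n //; nia.
have step p (K : R) : (forall m, 'N (x - s m ** x) <= K * e (p.+1 * m)) ->
    forall m, 'N (qprod x m - s m ** qprod x m) <= K * e (p * m).
  move=> xK m; apply: le_trans (qprod_step _ _) _.
  have -> : K * e (p * m) = 2 ^+ m * (K * e (p.+1 * m)).
    by rewrite mulSn exprD mulrCA (mulrA (2 ^+ m)) e_expn mul1r.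
  by rewrite ler_wpM2l ?exprn_ge0.
have step' m : qprod x m.+1 - qprod x m = qprod x m - s m ** qprod x m.
  by rewrite /= [LHS]addrAC subrr add0r.
have [K1 xK1] := x_rapid 2%N.
have [|y y_lim] := @geometric_limit _ _ (qprod x) K1.
  by move=> j; rewrite step'; have := step 1%N _ xK1 j; rewrite mul1n.
(* Of the two extra orders of decay, one is spent on the factor [2^m] in [step], the other yields
   the geometric ratio in [j]. *)
have y_le p (K : R) : (forall m, 'N (x - s m ** x) <= K * e (p.+2 * m)) ->
    forall m, 'N (y - qprod x m) <= 2 * (K * e (p * m)).
  move=> xK m; apply: y_lim => j; rewrite step'.
  apply: le_trans (step _ _ xK _) _.
  have K0 : 0 <= K.
    by have := xK 0%N; rewrite muln0 expr0 mulr1; apply: le_trans (rnorm_ge0 _).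
  rewrite -mulrA -exprD ler_wpM2l // e_homo //; nia.
have y_rapid : rapid y.
  move=> p; have [K xK] := x_rapid p.+2; exists (3 * K) => m.
  set v := qprod x m.
  have -> : y - s m ** y = (y - v - s m ** (y - v)) + (v - s m ** v).
    by algebra_over (R[i]); ring.
  apply: le_trans (rnormD _ _) _.
  have := r_sub_le (m * m + m).+1 (y - v); rewrite -/(s m).
  have := y_le _ _ xK m; rewrite -/v; have := step _ _ xK m; rewrite -/v.
  have : K * e (p.+1 * m) <= K * e (p * m).
    have K0 : 0 <= K.
      have := xK 0%N; rewrite muln0 expr0 mulr1.
      exact: le_trans (rnorm_ge0 _).
    by rewrite ler_wpM2l // e_homo //; nia.
  lra.
exists y => //; apply/eqP; rewrite -subr_eq0; apply/eqP.
have [K xK] := x_rapid 3%N.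
have K0 : 0 <= K.
  by have := xK 0%N; rewrite muln0 expr0 mulr1; apply: le_trans (rnorm_ge0 _).
apply: (@rnorm_small _ _ _ (5 * ('N y + 2 * K) + 'N b * (2 * K))) => n.
have := y_le _ _ xK n; rewrite mul1n; set v := qprod x n => yv.
(* The first two terms are at most [e_n |v|] and [4 e_n |v|], whence the 5 in the constant. *)
have -> : x - b ** y = (e n)%:C *: v - (b - pprod n) ** v - b ** (y - v).
  by rewrite -{1}(pprod_qprod x n) -/v; algebra_over (R[i]); ring.
have v_le : 'N v <= 'N y + 2 * K.
  have -> : v = y - (y - v) by rewrite subKr.
  apply: le_trans (rnormB _ _) _; rewrite lerD2l; apply: le_trans yv _.
  by have := e_le1 n; nra.
apply: le_trans (rnormB _ _) _; rewrite mulrDl; apply: lerD.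
  apply: le_trans (rnormB _ _) _; rewrite rnormZ gtr0_norm //.
  have := rnormM (b - pprod n) v.
  have := ler_wpM2r (rnorm_ge0 v) (b_le n).
  have := ler_wpM2l (ltW (e_gt0 n)) v_le; lra.
apply: le_trans (rnormM _ _) _.
by have := ler_wpM2l (rnorm_ge0 b) yv; lra.
Qed.
End Factorization.

(** * Nilpotency modulo an ideal *)

Section Ideals.
Variables (R : realType) (A : cstarAlgType R).
Implicit Types (x y z a b c h s : A) (k : R[i]) (I J K S : set A).
Local Notation "'N x" := (rnorm x) (at level 10, x at level 8).

Definition two_sided J : Prop :=
  [/\ J 0, forall k x y, J x -> J y -> J (k *: x + y),
      forall a x, J x -> J (a ** x) & forall a x, J x -> J (x ** a)].

Lemma idealP J : ideal J <-> two_sided J.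
Proof.
split=> [[/linear_subspaceP[J0 JD] JL JR]|[J0 JD JL JR]].
  by split=> // a x Jx; [apply: JL|apply: JR]; apply: mul_spanM.
have sJ : linear_subspace J by apply/linear_subspaceP; split.
by split=> //; apply: lspan_min => // _ [x ? [y ? <-]]; [apply: JL|apply: JR].
Qed.

(** In this form, generation shows that every element has a property once that property defines an
    ideal containing [S]. *)
Lemma generatesP S :
  generates_as_ideal (lspan S) <->
  forall J, two_sided J -> S `<=` J -> J = setT.
Proof.
rewrite /generates_as_ideal ideal_spanE; last exact: lspan_subspace.
split=> [genS J J2 SJ|genS].
  apply/seteqP; split=> // x _.
  have : smallest (@ideal R A) (lspan S) x by rewrite genS.
  apply; split; first exact/idealP.
  by apply: lspan_min => //; case/idealP: J2.
apply/seteqP; split=> // x _ J [/idealP J2 SJ].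
have -> // : J = setT.
by apply: genS => // y Sy; apply: SJ; apply: sub_lspan.
Qed.

Section TwoSided.
Variable (J : set A).
Hypothesis J2 : two_sided J.

Lemma two_sidedZ k x : J x -> J (k *: x).
Proof. by case: J2 => J0 JD _ _ Jx; rewrite -[_ *: _]addr0; apply: JD. Qed.

Lemma two_sidedD x y : J x -> J y -> J (x + y).
Proof. by case: J2 => _ JD _ _ Jx Jy; rewrite -[x]scale1r; apply: JD. Qed.

Lemma two_sidedN x : J x -> J (- x).
Proof. by rewrite -scaleN1r; apply: two_sidedZ. Qed.

Lemma two_sidedB x y : J x -> J y -> J (x - y).
Proof. by move=> Jx Jy; apply: two_sidedD => //; apply: two_sidedN. Qed.

Lemma two_sidedMl a x : J x -> J (a ** x).
Proof. by case: J2 => _ _ + _; apply. Qed.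

Lemma two_sidedMr a x : J x -> J (x ** a).
Proof. by case: J2 => _ _ _; apply. Qed.
End TwoSided.

(** The ideal generated by [J] and [s], encoded so that membership is itself an induction
    principle. *)
Definition adjoin J s : set A :=
  fun x => forall K, two_sided K -> J `<=` K -> K s -> K x.

Lemma adjoin_two_sided J s : two_sided (adjoin J s).
Proof.
split=> [K []//|k x y Jx Jy K K2 JK Ks|a x Jx K K2 JK Ks|a x Jx K K2 JK Ks].
- by case: (K2) => _ KD _ _; apply: KD; [apply: Jx|apply: Jy].
- by apply: two_sidedMl => //; apply: Jx.
- by apply: two_sidedMr => //; apply: Jx.
Qed.

Lemma sub_adjoin J s : J `<=` adjoin J s.
Proof. by move=> x Jx K _ JK _; apply: JK. Qed.

Lemma mem_adjoin J s : adjoin J s s.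
Proof. by move=> K. Qed.

Lemma adjoin_min J K s : two_sided K -> J `<=` K -> K s -> adjoin J s `<=` K.
Proof. by move=> K2 JK Ks x; apply. Qed.

Lemma adjoinM J s : two_sided J -> J (s ** s) -> (forall a, J (s ** a ** s)) ->
  forall x y, adjoin J s x -> adjoin J s y -> J (x ** y).
Proof.
move=> J2 Jss Jsas; have K2 := adjoin_two_sided J s.
have [J0 JD JL JR] := J2.
(* Induction on the right factor, with left factor [s] or [sa]; the left factor is treated
   afterwards. *)
have sK y : adjoin J s y -> J (s ** y) /\ forall a, J (s ** a ** y).
  move=> /(_ (fun y => J (s ** y) /\ forall a, J (s ** a ** y))); apply=> //.
    split=> [|k u v [su sau] [sv sav]|b u [su sau]|b u [su sau]].
    - by rewrite cmulx0; split=> // a; rewrite cmulx0.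
    - rewrite cmulDr cmulZr.
      by split=> [|a]; rewrite ?cmulDr ?cmulZr; apply: JD.
    - by rewrite cmulA; split=> // a; rewrite cmulA -(cmulA s a b).
    - by rewrite cmulA; split=> [|a]; rewrite ?cmulA; apply: JR.
  by move=> u Ju; split=> [|a]; apply: JL.
move=> x y /(_ (fun x => forall y, adjoin J s y -> J (x ** y))) Kx.
move: y; apply: Kx.
- split=> [y _|k u v uK vK y Ky|b u uK y Ky|b u uK y Ky].
  + by rewrite cmul0x.
  + by rewrite cmulDl cmulZl; apply: JD; [apply: uK|apply: vK].
  + by rewrite -cmulA; apply/JL/uK.
  + by rewrite -cmulA; apply: uK; apply: (two_sidedMl K2).
- by move=> u Ju y _; apply: JR.
- by move=> y /sK[].
Qed.

Definition square x := x ** x.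

(* Quantifying over all [J] above [I] makes this condition stable under sums,
   see [nil_mod_two_sided]. *)
Definition nil_mod I s : Prop := forall J, two_sided J -> I `<=` J ->
  forall x, adjoin J s x -> exists n, J (iter n square x).

Lemma nil_mod_two_sided I : two_sided (nil_mod I).
Proof.
have mono x y : (forall J, two_sided J -> J x -> J y) ->
    nil_mod I x -> nil_mod I y.
  move=> xy nx J J2 IJ z zy; apply: (nx J) => //.
  have J'2 := adjoin_two_sided J x.
  apply: adjoin_min zy => //; first exact: sub_adjoin.
  by apply: xy => //; apply: mem_adjoin.
split=> [J J2 IJ x x0|k x y nx ny J J2 IJ z zxy|a x|a x].
- by exists 0%N; apply: adjoin_min x0 => //; case: J2.
- have J'2 := adjoin_two_sided J x; have JJ' := @sub_adjoin J x.
  have J''2 := adjoin_two_sided (adjoin J x) y.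
  have J'J'' := @sub_adjoin (adjoin J x) y.
  (* [ny] is applied over the larger ideal [adjoin J x]; [nx] then brings a further power into
     [J]. *)
  have [n zn] : exists n, adjoin J x (iter n square z).
    apply: ny (subset_trans IJ JJ') _ _ => //.
    apply: adjoin_min zxy => //; first exact: subset_trans JJ' J'J''.
    case: (J''2) => _ + _ _; apply; last exact: mem_adjoin.
    by apply: J'J''; apply: mem_adjoin.
  have [m zm] := nx _ J2 IJ _ zn.
  by exists (m + n)%N; rewrite iterD.
- by apply: mono => J J2; apply: two_sidedMl.
- by apply: mono => J J2; apply: two_sidedMr.
Qed.

Lemma nil_mod_square I s :
  I (s ** s) -> (forall a, I (s ** a ** s)) -> nil_mod I s.
Proof.
move=> Iss Isas J J2 IJ x xs; exists 1%N.
by apply: (adjoinM J2 _ _ xs xs) => [|a]; apply: IJ.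
Qed.

(** Two squarings, through the ideal [K] generated by [J] and [c^2]: centrality of [c] modulo [J]
    puts the square of the ideal generated by [J] and [c] into [K], and [c^3] in [J] puts that of
    [K] into [J]. *)
Lemma nil_mod_cube I c : (forall a, I (c ** a - a ** c)) -> I (c ** c ** c) ->
  nil_mod I c.
Proof.
move=> Icomm Iccc J J2 IJ x xc; exists 2%N => /=.
have K2 := adjoin_two_sided J (c ** c).
have JK := @sub_adjoin J (c ** c).
have Jcomm a : J (c ** a - a ** c) by exact: IJ.
have Jccc : J (c ** c ** c) by exact: IJ.
have sqx : adjoin J (c ** c) (square x).
  have x' : adjoin (adjoin J (c ** c)) c x.
    apply: adjoin_min xc; first exact: adjoin_two_sided.
      exact: subset_trans JK (@sub_adjoin _ _).
    exact: mem_adjoin.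
  apply: (adjoinM K2 _ _ x' x') => [|a]; first exact: mem_adjoin.
  have -> : c ** a ** c = c ** (c ** a) - c ** (c ** a - a ** c).
    by algebra_over (R[i]); ring.
  apply: (two_sidedB K2); last by apply: (two_sidedMl K2); apply: JK.
  by rewrite cmulA; apply: (two_sidedMr K2); apply: mem_adjoin.
apply: (adjoinM J2 _ _ sqx sqx) => [|a].
  by rewrite cmulA; apply: (two_sidedMr J2).
have -> : c ** c ** a ** (c ** c)
    = c ** c ** c ** (a ** c) - c ** c ** (c ** a - a ** c) ** c.
  by algebra_over (R[i]); ring.
apply: (two_sidedB J2); first exact: (two_sidedMr J2).
by apply: (two_sidedMr J2); apply: (two_sidedMl J2).
Qed.

Lemma iter_square_factor (X : set A) b n :
  (forall x, X x -> exists2 y, X y & x = b ** y) ->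
  forall x, X x -> exists2 y, X y & x = iter n square b ** y.
Proof.
move=> bX; elim: n => [//|n IH] x /IH[y /IH[z Xz ->] ->].
by exists z; rewrite // cmulA.
Qed.

Lemma nil_quotient I : two_sided I ->
  (forall b, exists n, I (iter n square b)) -> I = setT.
Proof.
move=> I2 nilI; apply/seteqP; split=> // x _.
have Ismall h : cadj h = h -> 'N h <= 2^-1 -> I h.
  move=> hh h_le; pose w := 'i *: h.
  have [r rE] := choice (fun j => @skew_resolvent _ _ h j w hh h_le).
  have lb y t := @skew_lower_bound _ _ h y t hh.
  have [b [w_rapid bP]] := factorization lb rE.
  (* The exponent depends on [b], so it matters that [b] was chosen before [n]. *)
  have [n Ibn] := nilI b.
  have [y _ wE] := iter_square_factor n bP w_rapid.
  have Iw : I ('i *: h) by rewrite wE; apply: two_sidedMr.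
  have -> : h = (- 'i) *: ('i *: h).
    by rewrite scalerA mulNr -expr2 sqrCi opprK scale1r.
  exact: two_sidedZ.
have Isa h : cadj h = h -> I h.
  (* Rescaling makes the norm at most 1/2; the [+ 1] keeps [c] nonzero when [h = 0]. *)
  move=> hh; pose c : R := 2 * ('N h + 1).
  have c0 : 0 < c by have := rnorm_ge0 h; rewrite /c; lra.
  have -> : h = c%:C *: (c^-1%:C *: h).
    by rewrite scalerA -rmorphM /= mulfV ?gt_eqF // scale1r.
  apply: (two_sidedZ I2); apply: Ismall.
    by rewrite cadjZ hh; congr (_ *: _); apply: conjc_real.
  rewrite rnormZ gtr0_norm ?invr_gt0 // mulrC ler_pdivrMr // /c.
  by have := rnorm_ge0 h; lra.
pose k : R[i] := ('i)%R.
have kk : k * k = -1 by rewrite -expr2 sqrCi.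
have -> : x = 2^-1 *: (x + cadj x) + (- (2^-1 * k)) *: (k *: (x - cadj x)).
  by rewrite scalerA mulNr -mulrA kk; module_over (R[i]); field.
have adjN y : cadj (- y) = - cadj y.
  by rewrite -scaleN1r cadjZ rmorphN1 scaleN1r.
apply: (two_sidedD I2); apply: (two_sidedZ I2); apply: Isa.
  by rewrite cadjD cadjK addrC.
rewrite cadjZ cadjD adjN cadjK.
rewrite /k conjCi.
by module_over (R[i]); ring.
Qed.

(** The elements that are [nil_mod I] form an ideal containing [S], hence all of [A]; taking [J = I]
    puts a power of each element into [I]. *)
Lemma nil_mod_generators I S : two_sided I ->
  (forall J, two_sided J -> S `<=` J -> J = setT) ->
  (forall s, S s -> nil_mod I s) -> I = setT.
Proof.
move=> I2 genS nilS; apply: nil_quotient => // b.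
have nilT := genS _ (nil_mod_two_sided I) nilS.
have nb : nil_mod I b by rewrite nilT.
by apply: (nb I) => //; apply: mem_adjoin.
Qed.
End Ideals.

(** * Lie ideals *)

Section LieIdeals.
Variables (R : realType) (A : cstarAlgType R).
Implicit Types (x y z a b c : A) (k : R[i]) (I J K L S X Y : set A).
Local Notation "[~ x , y ]" := (commutator x y).

Lemma comm_spanS X Y X' Y' :
  X `<=` X' -> Y `<=` Y' -> comm_span X Y `<=` comm_span X' Y'.
Proof.
move=> XX' YY'; apply: lspan_min; first exact: lspan_subspace.
move=> _ [x /XX' X'x [y /YY' Y'y <-]].
by apply: sub_lspan; exists x => //; exists y.
Qed.

Lemma comm_spanM X Y x y : X x -> Y y -> comm_span X Y [~ x, y].
Proof. by move=> Xx Yy; apply: sub_lspan; exists x => //; exists y. Qed.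

Lemma generatesS S S' : S `<=` S' -> linear_subspace S -> linear_subspace S' ->
  generates_as_ideal S -> generates_as_ideal S'.
Proof.
move=> SS' sS sS'; rewrite /generates_as_ideal !ideal_spanE // => genS.
apply/seteqP; split=> // x _ J [idJ S'J].
have : smallest (@ideal R A) S x by rewrite genS.
by apply; split=> //; apply: subset_trans S'J.
Qed.

Section Subspace.
Variables (X : set A).
Hypothesis X1 : linear_subspace X.

Lemma subspaceZ k x : X x -> X (k *: x).
Proof.
by case/linear_subspaceP: X1 => X0 XD Xx; rewrite -[_ *: _]addr0; apply: XD.
Qed.

Lemma subspaceD x y : X x -> X y -> X (x + y).
Proof.
by case/linear_subspaceP: X1 => _ XD Xx Xy; rewrite -[x]scale1r; apply: XD.
Qed.

Lemma subspaceB x y : X x -> X y -> X (x - y).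
Proof.
move=> Xx Xy; rewrite -scaleN1r addrC; move/linear_subspaceP: X1 => [_]; exact.
Qed.
End Subspace.

Section LieIdeal.
Variable L : set A.
Hypothesis L1 : lie_ideal L.

Lemma lie_idealMl a x : L x -> L [~ a, x].
Proof. by case: L1 => _ AL Lx; apply: AL; apply: comm_spanM. Qed.

Lemma lie_idealMr a x : L x -> L [~ x, a].
Proof.
move=> Lx; have -> : [~ x, a] = (-1) *: [~ a, x] by algebra_over (R[i]); ring.
by apply: subspaceZ; [case: L1|apply: lie_idealMl].
Qed.

Lemma comm_span_sub : comm_span L L `<=` L.
Proof.
apply: lspan_min; first by case: L1.
by move=> _ [x Lx [y _ <-]]; apply: lie_idealMr.
Qed.

Lemma lie_ideal_comm : lie_ideal (comm_span L L).
Proof.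
have sLL : linear_subspace (comm_span L L) by exact: lspan_subspace.
split=> //; apply: lspan_min => // _ [a _ [z LLz <-]].
move: z LLz; apply: (@lspan_min _ _ _ (fun z => comm_span L L [~ a, z])).
  apply/linear_subspaceP.
  have /linear_subspaceP[S0 SD] := sLL.
  split=> [|k x y Lx Ly]; first by rewrite /commutator cmulx0 cmul0x subr0.
  have -> : [~ a, k *: x + y] = k *: [~ a, x] + [~ a, y].
    by algebra_over (R[i]); ring.
  exact: SD.
move=> _ [x Lx [y Ly <-]].
(* The Jacobi identity. *)
have -> : [~ a, [~ x, y]] = [~ [~ a, x], y] + [~ x, [~ a, y]].
  by algebra_over (R[i]); ring.
apply: (subspaceD sLL).
  by apply: comm_spanM => //; apply: lie_idealMl.
by apply: comm_spanM => //; apply: lie_idealMl.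
Qed.

(* With [d := [x, -]] one has [d^2 = 0] modulo [I], so that
   [2 d(a) d(b) = d^2(ab) - d^2(a) b - a d^2(b)] lies in [I], and then so does
   [d(a) b d(a) = d(a) d(ba) - d(a) d(b) a]. *)
Lemma nil_mod_comm I a x : two_sided I -> comm_span L L `<=` I -> L x ->
  nil_mod I [~ x, a].
Proof.
move=> I2 LLI Lx.
have dd b : I [~ x, [~ x, b]].
  by apply: LLI; apply: comm_spanM => //; apply: lie_idealMr.
have dMd b c : I ([~ x, b] ** [~ x, c]).
  have -> : [~ x, b] ** [~ x, c] = 2^-1 *: ([~ x, [~ x, b ** c]]
      - ([~ x, [~ x, b]] ** c + b ** [~ x, [~ x, c]])).
    by algebra_over (R[i]); field.
  apply: (two_sidedZ I2); apply: (two_sidedB I2) => //.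
  by apply: (two_sidedD I2); [apply: (two_sidedMr I2)|apply: (two_sidedMl I2)].
apply: nil_mod_square => // b.
have -> : [~ x, a] ** b ** [~ x, a]
    = [~ x, a] ** [~ x, b ** a] - [~ x, a] ** [~ x, b] ** a.
  by algebra_over (R[i]); ring.
by apply: (two_sidedB I2) => //; apply: (two_sidedMr I2).
Qed.

Lemma generates_comm : generates_as_ideal (comm_span setT L) ->
  generates_as_ideal (comm_span L L).
Proof.
move=> /generatesP genAL; apply/generatesP => I I2 LLI.
apply: (nil_mod_generators I2 genAL) => _ [a _ [x Lx <-]].
have LLI' : comm_span L L `<=` I.
  by apply: lspan_min => //; case/idealP: I2.
have -> : [~ a, x] = (-1) *: [~ x, a] by algebra_over (R[i]); ring.
by apply: (two_sidedZ (nil_mod_two_sided I)); apply: nil_mod_comm.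
Qed.

(* For [c := [x, y]], the element [z(a) := [x, [y, a]]] of [[L, L]] is central
   modulo [I].  Commuting [z(ay) = z(a) y + [y, a] c] with [x] gives
   [2 z(a) c = 0], and [z(xy) = - [x, c] y - c^2] then gives [c^3 = 0]. *)
Lemma comm_cube I x y : two_sided I -> comm_span setT (comm_span L L) `<=` I ->
  L x -> L y -> I ([~ x, y] ** [~ x, y] ** [~ x, y]).
Proof.
move=> I2 AI Lx Ly; set c := [~ x, y].
have centr a z : comm_span L L z -> I [~ a, z].
  by move=> LLz; apply: AI; apply: comm_spanM.
have LLz a : comm_span L L [~ x, [~ y, a]].
  by apply: comm_spanM => //; apply: lie_idealMr.
have LLc : comm_span L L c by exact: comm_spanM.
have zc a : I ([~ x, [~ y, a]] ** c).
  have -> : [~ x, [~ y, a]] ** c = 2^-1 *: ([~ x, [~ x, [~ y, a ** y]]]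
      - ([~ x, [~ x, [~ y, a]]] ** y + [~ y, a] ** [~ x, c])).
    by rewrite /c; algebra_over (R[i]); field.
  apply: (two_sidedZ I2); apply: (two_sidedB I2); first exact: centr.
  apply: (two_sidedD I2); first by apply: (two_sidedMr I2); apply: centr.
  by apply: (two_sidedMl I2); apply: centr.
have -> : c ** c ** c = - ([~ x, [~ y, x ** y]] ** c + [~ x, c] ** (y ** c)).
  by rewrite /c; algebra_over (R[i]); ring.
apply: (two_sidedN I2); apply: (two_sidedD I2) => //.
by apply: (two_sidedMr I2); apply: centr.
Qed.

Lemma generates_comm_comm : generates_as_ideal (comm_span L L) ->
  generates_as_ideal (comm_span setT (comm_span L L)).
Proof.
move=> /generatesP genLL; apply/generatesP => I I2 AI.
apply: (nil_mod_generators I2 genLL) => _ [x Lx [y Ly <-]].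
have AI' : comm_span setT (comm_span L L) `<=` I.
  by apply: lspan_min => //; case/idealP: I2.
apply: nil_mod_cube; last exact: comm_cube.
move=> a; have -> : [~ x, y] ** a - a ** [~ x, y] = (-1) *: [~ a, [~ x, y]].
  by algebra_over (R[i]); ring.
apply: (two_sidedZ I2); apply: AI'.
by apply: comm_spanM => //; apply: comm_spanM.
Qed.

(* [T := {t | [t, A] `<=` L}] is a Lie ideal and, by
   [[st, a] = [s, ta] + [t, as]], a subring; so [[s, t] a = [s, ta] - t [s, a]]
   puts the ideal generated by [[T, T]] into [T]. *)
Lemma comm_sub_of_generates : generates_as_ideal (comm_span L L) ->
  comm_span setT setT `<=` L.
Proof.
move=> /generatesP genLL; have sL : linear_subspace L by case: L1.
have /linear_subspaceP[L0 LD] := sL.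
pose T : set A := fun t => forall a, L [~ t, a].
have LT : L `<=` T by move=> x Lx a; apply: lie_idealMr.
have T1 : linear_subspace T.
  apply/linear_subspaceP; split=> [a|k x y Tx Ty a].
    by rewrite /commutator cmulx0 cmul0x subr0.
  have -> : [~ k *: x + y, a] = k *: [~ x, a] + [~ y, a].
    by algebra_over (R[i]); ring.
  by apply: LD; [apply: Tx|apply: Ty].
have TM s t : T s -> T t -> T (s ** t).
  move=> Ts Tt a.
  have -> : [~ s ** t, a] = [~ s, t ** a] + [~ t, a ** s].
    by algebra_over (R[i]); ring.
  by apply: (subspaceD sL); [apply: Ts|apply: Tt].
have Tcomm t a : T t -> T [~ t, a] by move=> Tt; apply/LT/Tt.
(* The largest two-sided ideal inside [T]; there are four clauses because [A] may lack a unit. *)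
pose J : set A := fun t => [/\ T t, forall a, T (t ** a), forall a, T (a ** t)
  & forall a b, T (a ** t ** b)].
have J2 : two_sided J.
  have /linear_subspaceP[T0 TD] := T1.
  split=> [|k x y [x0 x1 x2 x3] [y0 y1 y2 y3]|a x [x0 x1 x2 x3]
    |a x [x0 x1 x2 x3]].
  - by split=> // *; rewrite ?(cmulx0, cmul0x) ?cmul0x.
  - by split=> *; rewrite ?(cmulDl, cmulDr, cmulZl, cmulZr); apply: TD.
  - by split=> // *; rewrite ?cmulA.
  - by split=> // *; rewrite ?cmulA // -cmulA; apply: x1 || apply: x3.
have JT : J = setT.
  apply: genLL => // _ [x Lx [y Ly <-]].
  have Tx := LT _ Lx; have Ty := LT _ Ly.
  have c0 : T [~ x, y] by exact: Tcomm.
  have c1 a : T ([~ x, y] ** a).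
    have -> : [~ x, y] ** a = [~ x, y ** a] - y ** [~ x, a].
      by algebra_over (R[i]); ring.
    apply: (subspaceB T1); first exact: Tcomm.
    by apply: TM => //; apply: Tcomm.
  (* A left factor [a] is moved to the right at the cost of a commutator of an element of [T], which
     stays in [T] by [Tcomm]. *)
  split=> // [a|a b].
    have -> : a ** [~ x, y] = [~ x, y] ** a - [~ [~ x, y], a].
      by algebra_over (R[i]); ring.
    by apply: (subspaceB T1) => //; apply: Tcomm.
  have -> : a ** [~ x, y] ** b = [~ x, y] ** (b ** a) - [~ [~ x, y] ** b, a].
    by algebra_over (R[i]); ring.
  by apply: (subspaceB T1) => //; apply: Tcomm.
apply: lspan_min => // _ [x _ [y _ <-]].
by have : J x; [rewrite JT|case=> Tx _ _ _; apply: Tx].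
Qed.
End LieIdeal.
End LieIdeals.

Theorem theoremB (R : realType) (A : cstarAlgType R) (L : set A)
    (hL : lie_ideal L) :
  ((generates_as_ideal (comm_span [set: A] L) <->
      generates_as_ideal (comm_span L L)) /\
   (generates_as_ideal (comm_span L L) <->
      generates_as_ideal (comm_span (comm_span L L) (comm_span L L)))) /\
  (generates_as_ideal (comm_span [set: A] L) ->
     comm_span [set: A] [set: A] = comm_span L L /\ comm_span L L `<=` L).
Proof.
have hLL := lie_ideal_comm hL.
have i_ii := generates_comm hL.
have ii_iii : generates_as_ideal (comm_span L L) ->
    generates_as_ideal (comm_span (comm_span L L) (comm_span L L)).
  by move=> /(generates_comm_comm hL); apply: generates_comm.
have sub X Y : linear_subspace (@comm_span R A X Y) by exact: lspan_subspace.
split; [split; split=> //|].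
- by apply: generatesS => //; apply: comm_spanS.
- by apply: generatesS => //; apply: comm_spanS; apply: comm_span_sub.
move=> /i_ii/ii_iii gen; split; last exact: comm_span_sub.
apply/seteqP; split; first exact: comm_sub_of_generates.
exact: comm_spanS.
Qed.
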